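(* For all integers $k,\ell\geqslant 1$ such that $1\leqslant \ell\leqslant 2k-2$, $$\zeta^{2}(2k-\ell)=\sum_{n=1}^{+\infty}\frac{b_{k,\ell}(n)}{n^{4k-2\ell-1}}.$$
   Context: $\zeta$ denotes the Riemann zeta function and $\psi(z)=\Gamma'(z)/\Gamma(z)$ the digamma function. For integers $k\geqslant 1$ and $r\geqslant 0$ put $\varepsilon_{r}=\varepsilon_{r}(k)=\exp\bigl(\frac{2\pi i(r+1/2)}{2k}\bigr)$. For real $w>0$ define $b_{k,\ell}(w)=\frac{(-1)^{\ell+1}}{k}\sum_{r=0}^{2k-1}\varepsilon_{r}^{\ell+1}\psi(\varepsilon_{r}w)$. *)

(* Defs.v *)
From Stdlib Require Import Reals Factorial.
From Coquelicot Require Import Coquelicot.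

Local Open Scope C_scope.

(* The complex number satisfying P, when there is exactly one. *)
Definition Cthe (P : C -> Prop) : C := iota (T := C_CompleteNormedModule) P.

Definition Clim_seq (u : nat -> C) : C :=
  Cthe (fun l => filterlim u eventually (locally l)).

Definition Cseries (a : nat -> C) : C :=
  Cthe (fun l => is_series (K := C_AbsRing) (V := C_NormedModule) a l).

(* Coquelicot's total operator C_derive takes the difference quotient along
   the horizontal direction only; this one is the complex derivative. *)
Definition Cderiv (f : C -> C) (z : C) : C :=
  Cthe (fun d => is_derive (K := C_AbsRing) (V := C_NormedModule) f z d).

Definition Cexp (z : C) : C :=
  RtoC (exp (Re z)) * (RtoC (cos (Im z)) + Ci * RtoC (sin (Im z))).

(* x ^ z for real x > 0, principal branch. *)
Definition Rcpow (x : R) (z : C) : C := Cexp (z * RtoC (ln x)).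

(* z (z + 1) ... (z + n - 1) *)
Fixpoint rising (z : C) (n : nat) : C :=
  match n with
  | O => 1
  | S m => rising z m * (z + RtoC (INR m))
  end.

(* Gauss's limit n! n^z / (z (z + 1) ... (z + n)), which gives the
   meromorphic Gamma function on the whole plane minus 0, -1, -2, ...; the
   term n = 0 is irrelevant. *)
Definition CGamma (z : C) : C :=
  Clim_seq (fun n => RtoC (INR (fact n)) * Rcpow (INR n) z / rising z (S n)).

Definition digamma (z : C) : C := Cderiv CGamma z / CGamma z.

(* The Dirichlet series of the Riemann zeta function, hence zeta itself only
   on the half-plane Re s > 1. *)
Definition zeta (s : C) : C := Cseries (fun n => Rcpow (INR (S n)) (- s)).

Definition eps (k r : nat) : C :=
  Cexp (2 * RtoC PI * Ci * (RtoC (INR r) + 1 / 2) / (2 * RtoC (INR k))).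

(* [sum_n f (2 * k - 1)] is the sum over r = 0, ..., 2k - 1. *)
Definition b (k l : nat) (w : R) : C :=
  Cpow (- (1)) (l + 1) / RtoC (INR k)
  * sum_n (G := C_AbelianMonoid)
      (fun r => Cpow (eps k r) (l + 1) * digamma (eps k r * RtoC w))
      (2 * k - 1).

(* Main.v *)
Require Import Defs.
From Stdlib Require Import Reals Factorial Lra Lia Psatz.
From Coquelicot Require Import Coquelicot.

Local Open Scope R_scope.

(** Write s = 2k - l.  The values of the digamma function at the points eps_r w
    are combined in b so that everything but a rational series cancels:
    [[
      b(w) = 2 sum_(m >= 1) m^l w^(2k-1-l) / (m^(2k) + w^(2k)),
    ]]
    and dividing by n^(4k-2l-1) gives
    b(n) / n^(4k-2l-1) = 2 sum_m t(n,m) with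
    t(n,m) = m^l / (n^s (m^(2k) + n^(2k))).  Since
    t(n,m) + t(m,n) = 1 / (n m)^s, the doubled sum of t over a square
    n, m <= N is the square of the partial sum of the zeta series, and
    positivity passes from squares to the iterated sum
    ([symmetric_double_series]).

    The formula for b ([b_converges]) needs only
    psi(z) = lim_n (ln n - sum_(j <= n) 1 / (z + j)) away from the poles
    ([digamma_converges]): the ln n are killed by sum_r eps_r^(l+1) = 0, and for
    each j the sum of eps_r^(l+1) / (eps_r w + j) over the roots of
    x^(2k) = -1 is a partial fraction computation
    ([sum_eps_partial_fraction]).

    The limit for psi is obtained without any theory of holomorphic functions.
    Let G_n(z) = n! n^z / (z (z+1) ... (z+n)).  Then G_n(z+h) / G_n(z) is a
    product of n+1 factors
    1 + h (c_j - 1/(z+j)) + O(|h|^2 / (j+1)^2), where the c_j are the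
    increments of the logarithm and sum to ln n.  An elementary second-order
    estimate for products ([Cprod_expansion]), uniform in n, therefore gives
    G(z+h) = G(z) (1 + h L + O(|h|^2)) for the limit G, where L is the limit of
    ln n - sum_(j <= n) 1 / (z+j); this is complex differentiability with
    G'(z) / G(z) = L.  Starting from z = 1, where G_n is n / (n+1), the same
    product for an arbitrary h shows that G_n converges to a nonzero limit. *)

(** * Finite sums and limits of complex sequences *)

(* These notations fix the carrier of [sum_n], so that sums written here agree
   syntactically with one another whatever structure inference would choose. *)

Notation Csum := (sum_n (G := C_AbelianMonoid)).
Notation Rsum := (sum_n (G := R_AbelianMonoid)).

Lemma Csum_S (u : nat -> C) n : Csum u (S n) = (Csum u n + u (S n))%C.
Proof. exact (sum_Sn (G := C_AbelianMonoid) u n). Qed.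

Lemma Rsum_S (u : nat -> R) n : Rsum u (S n) = Rsum u n + u (S n).
Proof. exact (sum_Sn (G := R_AbelianMonoid) u n). Qed.

Lemma Csum_scal (a : C) (u : nat -> C) n :
  Csum (fun j => a * u j)%C n = (a * Csum u n)%C.
Proof. exact (sum_n_mult_l (K := C_Ring) a u n). Qed.

Lemma Csum_minus (u v : nat -> C) n :
  Csum (fun j => u j - v j)%C n = (Csum u n - Csum v n)%C :> C.
Proof.
  induction n as [|n IH]; [now rewrite !sum_O|].
  rewrite !Csum_S, IH; ring.
Qed.

Lemma Csum_ext (u v : nat -> C) n :
  (forall j, (j <= n)%nat -> u j = v j) -> Csum u n = Csum v n :> C.
Proof. apply (sum_n_ext_loc (G := C_AbelianMonoid)). Qed.

Lemma Rsum_ext (u v : nat -> R) n :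
  (forall j, u j = v j) -> Rsum u n = Rsum v n :> R.
Proof. apply (sum_n_ext (G := R_AbelianMonoid)). Qed.

Lemma Rsum_scal (a : R) (u : nat -> R) n :
  Rsum (fun j => a * u j) n = a * Rsum u n.
Proof. exact (sum_n_mult_l (K := R_Ring) a u n). Qed.

Lemma Csum_RtoC (u : nat -> R) n :
  Csum (fun j => RtoC (u j)) n = RtoC (Rsum u n).
Proof.
  induction n as [|n IH]; [now rewrite !sum_O|].
  now rewrite Csum_S, Rsum_S, IH, RtoC_plus.
Qed.

Lemma Cmod_Csum_le (u : nat -> C) n :
  Cmod (Csum u n) <= Rsum (fun j => Cmod (u j)) n.
Proof. exact (norm_sum_n_m (V := C_NormedModule) u 0 n). Qed.

Lemma Rsum_le (u v : nat -> R) n :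
  (forall j, u j <= v j) -> Rsum u n <= Rsum v n.
Proof. intros H; apply sum_n_m_le, H. Qed.

Lemma Rsum_ge_0 (u : nat -> R) n : (forall j, 0 <= u j) -> 0 <= Rsum u n.
Proof.
  intros H; induction n as [|n IH]; [rewrite sum_O; apply H|].
  rewrite Rsum_S; specialize (H (S n)); lra.
Qed.

(** Convergence in C read off a real sequence, so that squeezing applies. *)
Definition converges (u : nat -> C) (l : C) : Prop :=
  is_lim_seq (fun n => Cmod (u n - l)) 0.

Lemma converges_filterlim (u : nat -> C) (l : C) :
  converges u l <-> filterlim u eventually (locally (T := C_UniformSpace) l).
Proof.
  unfold converges; rewrite <- is_lim_seq_spec; split; intros H.
  - intros P HP.
    apply (locally_norm_le_locally (V := C_NormedModule)) in HP.
    destruct HP as [eps HP]. destruct (H eps) as [N HN].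
    exists N; intros n Hn. apply HP. specialize (HN n Hn).
    rewrite Rminus_0_r, Rabs_pos_eq in HN by apply Cmod_ge_0. exact HN.
  - intros eps.
    destruct (H _ (locally_le_locally_norm (V := C_NormedModule) l _
      (locally_norm_ball_norm (V := C_NormedModule) l eps))) as [N HN].
    exists N; intros n Hn. specialize (HN n Hn).
    rewrite Rminus_0_r, Rabs_pos_eq by apply Cmod_ge_0. exact HN.
Qed.

Lemma is_series_converges (u : nat -> C) (l : C) :
  is_series (K := C_AbsRing) (V := C_NormedModule) u l <->
  converges (Csum u) l.
Proof. rewrite converges_filterlim; reflexivity. Qed.

Lemma converges_unique (u : nat -> C) (l l' : C) :
  converges u l -> converges u l' -> l = l'.
Proof.
  rewrite !converges_filterlim; intros H H'.
  exact (filterlim_locally_unique (V := C_NormedModule) u l l' H H').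
Qed.

Lemma Clim_seq_converges (u : nat -> C) (l : C) :
  converges u l -> Clim_seq u = l.
Proof.
  rewrite converges_filterlim; intros H.
  exact (iota_filterlim_locally (V := C_CompleteNormedModule) u l H).
Qed.

Lemma converges_le (u : nat -> C) (l : C) (e : nat -> R) :
  eventually (fun n => Cmod (u n - l) <= e n) -> is_lim_seq e 0 ->
  converges u l.
Proof.
  intros [N HN] He.
  apply (is_lim_seq_le_le_loc (fun _ => 0) _ e);
    [exists N; intros n Hn; split; [apply Cmod_ge_0|auto]
    |apply is_lim_seq_const|exact He].
Qed.

Lemma converges_ext (u v : nat -> C) (l : C) :
  (forall n, u n = v n) -> converges u l -> converges v l.
Proof.
  intros H Hu; apply is_lim_seq_ext with (2 := Hu); intros n; now rewrite H.
Qed.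

Lemma converges_const (a : C) : converges (fun _ => a) a.
Proof.
  apply is_lim_seq_ext with (fun _ => 0); [|apply is_lim_seq_const].
  intros _; rewrite <- Cmod_0; f_equal; ring.
Qed.

Lemma converges_plus (u v : nat -> C) (a b : C) :
  converges u a -> converges v b -> converges (fun n => u n + v n)%C (a + b)%C.
Proof.
  intros Hu Hv.
  apply converges_le with (fun n => Cmod (u n - a) + Cmod (v n - b)).
  - exists O; intros n _.
    replace (u n + v n - (a + b))%C with ((u n - a) + (v n - b))%C by ring.
    apply Cmod_triangle.
  - replace (Finite 0) with (Finite (0 + 0)) by (f_equal; ring).
    now apply is_lim_seq_plus'.
Qed.

Lemma converges_mult (u v : nat -> C) (a b : C) :
  converges u a -> converges v b -> converges (fun n => u n * v n)%C (a * b)%C.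
Proof.
  intros Hu Hv.
  apply converges_le with (fun n => Cmod (u n - a) * Cmod (v n - b)
    + Cmod (u n - a) * Cmod b + Cmod a * Cmod (v n - b)).
  - exists O; intros n _.
    replace (u n * v n - a * b)%C
      with ((u n - a) * (v n - b) + (u n - a) * b + a * (v n - b))%C by ring.
    rewrite <- !Cmod_mult.
    eapply Rle_trans; [apply Cmod_triangle|].
    apply Rplus_le_compat_r, Cmod_triangle.
  - replace (Finite 0) with (Finite (0 * 0 + 0 * Cmod b + Cmod a * 0))
      by (f_equal; ring).
    repeat apply is_lim_seq_plus'; apply is_lim_seq_mult';
      try apply is_lim_seq_const; assumption.
Qed.

Lemma converges_scal (c : C) (u : nat -> C) (a : C) :
  converges u a -> converges (fun n => c * u n)%C (c * a)%C.
Proof. apply converges_mult, converges_const. Qed.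

Lemma converges_Csum (u : nat -> nat -> C) (a : nat -> C) N :
  (forall r, (r <= N)%nat -> converges (fun n => u n r) (a r)) ->
  converges (fun n => Csum (u n) N) (Csum a N).
Proof.
  induction N as [|N IH]; intros H.
  - rewrite sum_O; apply converges_ext with (fun n => u n O);
      [intros n; now rewrite sum_O|now apply H].
  - rewrite Csum_S.
    apply converges_ext with (fun n => Csum (u n) N + u n (S N))%C;
      [intros n; now rewrite Csum_S|].
    apply converges_plus; [apply IH; intros r Hr|]; apply H; lia.
Qed.

Lemma converges_Cmod_le (u : nat -> C) (l a : C) (M : R) :
  converges u l -> (forall n, Cmod (u n - a) <= M) -> Cmod (l - a) <= M.
Proof.
  intros Hu HM.
  enough (H : Rbar_le (Cmod (l - a)) (0 + M)) by (simpl in H; lra).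
  apply is_lim_seq_le
    with (fun _ : nat => Cmod (l - a)) (fun n => Cmod (u n - l) + M).
  - intros n. replace (l - a)%C with (-(u n - l) + (u n - a))%C by ring.
    eapply Rle_trans; [apply Cmod_triangle|].
    rewrite Cmod_opp; specialize (HM n); lra.
  - apply is_lim_seq_const.
  - apply is_lim_seq_plus'; [exact Hu|apply is_lim_seq_const].
Qed.

(** * Infinite products of complex numbers *)

(** Indexed from 0 to n inclusive, like [sum_n]. *)
Fixpoint Cprod (u : nat -> C) (n : nat) : C :=
  match n with
  | O => u O
  | S m => Cprod u m * u (S m)
  end%C.

Lemma Cprod_ext (u v : nat -> C) n :
  (forall j, u j = v j) -> Cprod u n = Cprod v n.
Proof. intros H; induction n as [|n IH]; simpl; now rewrite ?IH, H. Qed.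

Lemma Cprod_mult (u v : nat -> C) n :
  Cprod (fun j => u j * v j)%C n = (Cprod u n * Cprod v n)%C.
Proof. induction n as [|n IH]; simpl; [|rewrite IH; ring]; reflexivity. Qed.

Lemma Cprod_1 n : Cprod (fun _ => 1%C) n = 1%C.
Proof. induction n as [|n IH]; simpl; [|rewrite IH; ring]; reflexivity. Qed.

Lemma exp_le_compat (x y : R) : x <= y -> exp x <= exp y.
Proof.
  intros [H|<-]; [left; now apply exp_increasing|apply Rle_refl].
Qed.

Lemma Cmod_Cprod_le (x : nat -> C) n :
  Cmod (Cprod (fun j => 1 + x j)%C n) <= exp (Rsum (fun j => Cmod (x j)) n).
Proof.
  assert (H1 : forall j, Cmod (1 + x j) <= exp (Cmod (x j))).
  { intros j. eapply Rle_trans; [apply Cmod_triangle|].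
    rewrite Cmod_1; apply exp_ineq1_le. }
  induction n as [|n IH]; [simpl; rewrite sum_O; apply H1|].
  rewrite Rsum_S, exp_plus; simpl; rewrite Cmod_mult.
  apply Rmult_le_compat; auto using Cmod_ge_0.
Qed.

(** The products of the 1 + x_j and of the 1 + |x_j| have the same expansion with
    x_j replaced by |x_j|, so the terms of degree at least 2 are bounded by those
    of the real product, hence by those of exp t.  The first bound is what makes
    the induction for the second one work. *)
Lemma Cprod_expansion (x : nat -> C) n :
  let t := Rsum (fun j => Cmod (x j)) n in
  Cmod (Cprod (fun j => 1 + x j)%C n - 1) <= exp t - 1 /\
  Cmod (Cprod (fun j => 1 + x j)%C n - 1 - Csum x n) <= exp t - 1 - t.
Proof.
  induction n as [|n [IH1 IH2]]; cbn zeta in *.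
  - rewrite !sum_O; simpl.
    replace (1 + x O - 1)%C with (x O) by ring.
    replace (x O - x O)%C with (RtoC 0) by ring.
    rewrite Cmod_0; pose proof (exp_ineq1_le (Cmod (x O))); lra.
  - rewrite Rsum_S, Csum_S, exp_plus; simpl.
    set (P := Cprod _ n) in *; set (t := Rsum _ n) in *.
    set (y := x (S n)).
    pose proof (exp_ineq1_le (Cmod y)); pose proof (exp_pos t).
    pose proof (Cmod_ge_0 y).
    assert (H3 : Cmod ((P - 1) * y) <= (exp t - 1) * Cmod y)
      by (rewrite Cmod_mult; now apply Rmult_le_compat_r).
    assert (H4 : exp t * (1 + Cmod y) <= exp t * exp (Cmod y))
      by (apply Rmult_le_compat_l; lra).
    split.
    + replace (P * (1 + y) - 1)%C with ((P - 1) + (P - 1) * y + y)%C by ring.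
      pose proof (Cmod_triangle (P - 1 + (P - 1) * y) y).
      pose proof (Cmod_triangle (P - 1) ((P - 1) * y)). nra.
    + replace (P * (1 + y) - 1 - (Csum x n + y))%C
        with ((P - 1 - Csum x n) + (P - 1) * y)%C by ring.
      pose proof (Cmod_triangle (P - 1 - Csum x n) ((P - 1) * y)). nra.
Qed.

Lemma ex_series_le_eventually (a : nat -> C) (b : nat -> R) :
  eventually (fun n => Cmod (a n) <= b n) -> ex_series b ->
  ex_series (K := C_AbsRing) (V := C_NormedModule) a.
Proof.
  intros [N HN] Hb.
  apply (ex_series_incr_n (V := C_NormedModule) a N).
  apply (ex_series_le (V := C_CompleteNormedModule) _ (fun n => b (N + n)%nat)).
  - intros n; apply HN; lia.
  - now apply (ex_series_incr_n (V := R_NormedModule) b N).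
Qed.

Lemma Rsum_le_Series (a : nat -> R) n :
  (forall j, 0 <= a j) -> ex_series a -> Rsum a n <= Series a.
Proof.
  intros Ha [s Hs]. rewrite (is_series_unique _ _ Hs).
  apply (is_lim_seq_incr_compare (Rsum a) s Hs).
  intros m; rewrite Rsum_S; specialize (Ha (S m)); lra.
Qed.

(** Consecutive partial products differ by P_n x_(n+1), and the P_n are bounded,
    so the partial products are the partial sums of an absolutely convergent
    series. *)
Lemma Cprod_converges (x : nat -> C) :
  ex_series (fun j => Cmod (x j)) ->
  exists P, converges (Cprod (fun j => 1 + x j)%C) P.
Proof.
  intros Hx. set (P := Cprod (fun j => 1 + x j)%C).
  set (v := fun j => match j with O => P O | S m => P m * x (S m) end%C).
  assert (Hv : forall n, Csum v n = P n).
  { induction n as [|n IH]; [now rewrite sum_O|].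
    rewrite Csum_S, IH; unfold v, P; simpl; ring. }
  set (M := exp (Series (fun j => Cmod (x j)))).
  destruct (ex_series_le_eventually v (fun j => M * Cmod (x j))) as [l Hl].
  - exists 1%nat; intros [|n] Hn; [lia|].
    unfold v; rewrite Cmod_mult.
    apply Rmult_le_compat_r; [apply Cmod_ge_0|].
    eapply Rle_trans; [apply Cmod_Cprod_le|].
    apply exp_le_compat, Rsum_le_Series; [intros; apply Cmod_ge_0|exact Hx].
  - now apply (ex_series_scal (V := R_NormedModule) M).
  - exists l. apply is_series_converges in Hl.
    now apply converges_ext with (Csum v).
Qed.

(** The product of the inverse factors also converges, because
    1 / (1 + x) - 1 = - x / (1 + x) is of the order of x; the product of the two
    limits is 1. *)
Lemma Cprod_limit_neq_0 (x : nat -> C) (P : C) :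
  ex_series (fun j => Cmod (x j)) -> (forall j, (1 + x j)%C <> 0%C) ->
  converges (Cprod (fun j => 1 + x j)%C) P -> P <> 0%C.
Proof.
  intros Hx Hnz HP.
  set (x' := fun j => (- (x j / (1 + x j)))%C).
  assert (Hx' : forall j, (1 + x' j = / (1 + x j))%C)
    by (intros j; unfold x'; field; apply Hnz).
  destruct (Cprod_converges x') as [Q HQ].
  - assert (E : eventually (fun j => norm (Cmod (x' j)) <= 2 * Cmod (x j))).
    { assert (L := ex_series_lim_0 _ Hx).
      apply is_lim_seq_spec in L.
      destruct (L (mkposreal (1 / 2) ltac:(lra))) as [N HN].
      exists N; intros n Hn; specialize (HN n Hn); simpl in HN.
      rewrite Rminus_0_r, Rabs_pos_eq in HN by apply Cmod_ge_0.
      change (norm (Cmod (x' n))) with (Rabs (Cmod (x' n))).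
      rewrite Rabs_pos_eq by apply Cmod_ge_0.
      unfold x'; rewrite Cmod_opp, Cmod_div by apply Hnz.
      assert (1 / 2 <= Cmod (1 + x n)).
      { pose proof (Cmod_triangle (1 + x n) (- x n)) as T.
        replace (1 + x n + - x n)%C with (RtoC 1) in T by ring.
        rewrite Cmod_1, Cmod_opp in T; lra. }
      apply Rle_div_l; [lra|]. pose proof (Cmod_ge_0 (x n)); nra. }
    destruct E as [N HN].
    apply (ex_series_incr_n (V := R_NormedModule) _ N).
    apply (ex_series_le (V := R_CompleteNormedModule) _
             (fun n => 2 * Cmod (x (N + n)%nat))).
    + intros n; apply HN; lia.
    + apply (ex_series_scal (V := R_NormedModule) 2).
      now apply (ex_series_incr_n (V := R_NormedModule) (fun j => Cmod (x j)) N).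
  - intros P0.
    apply C1_nz.
    assert (H1 : converges (fun _ => 1%C) (P * Q)%C).
    { apply converges_ext with (2 := converges_mult _ _ _ _ HP HQ).
      intros n; rewrite <- Cprod_mult.
      rewrite (Cprod_ext _ (fun _ => 1%C)); [apply Cprod_1|].
      intros j; cbv beta; rewrite Hx'; now apply Cinv_r. }
    rewrite (converges_unique _ _ _ (converges_const 1%C) H1), P0; ring.
Qed.

(** * Second-order bounds for the exponential *)

(** The upper bound is 1 + x <= exp x at - x, i.e. exp x <= 1 / (1 - x), and
    1 / (1 - x) <= 1 + x + 2 x^2 as long as x <= 1/2. *)
Lemma exp_expansion_le (x : R) :
  Rabs x <= 1 / 2 -> Rabs (exp x - 1 - x) <= 2 * x ^ 2.
Proof.
  intros Hx; apply Rabs_le_between in Hx.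
  assert (H1 := exp_ineq1_le x). assert (H2 := exp_ineq1_le (- x)).
  assert (H3 : exp x * exp (- x) = 1)
    by (rewrite <- exp_plus, Rplus_opp_r; apply exp_0).
  assert (H4 : exp x * (1 - x) <= 1) by (pose proof (exp_pos x); nra).
  assert (H5 : 0 <= x ^ 2 * (1 - 2 * x))
    by (apply Rmult_le_pos; [apply pow2_ge_0|lra]).
  rewrite Rabs_pos_eq by lra. nra.
Qed.

Lemma Rabs_sin_le (t : R) : Rabs (sin t) <= Rabs t.
Proof.
  replace (sin t) with (sin t - sin 0) by (rewrite sin_0; ring).
  replace (Rabs t) with (1 * Rabs (t - 0)) by (rewrite Rminus_0_r; ring).
  apply bounded_variation with (dh := cos); intros u _; split.
  - apply is_derive_Reals, derivable_pt_lim_sin.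
  - apply Rabs_le; destruct (COS_bound u); lra.
Qed.

Lemma Rabs_cos_sub_1_le (t : R) : Rabs (cos t - 1) <= t ^ 2 / 2.
Proof.
  replace (cos t) with (cos (2 * (t / 2))) by (f_equal; field).
  rewrite cos_2a_sin.
  assert (H : sin (t / 2) ^ 2 <= (t / 2) ^ 2)
    by (rewrite <- !Rsqr_pow2; apply Rsqr_le_abs_1, Rabs_sin_le).
  replace (1 - 2 * sin (t / 2) * sin (t / 2) - 1)
    with (- (2 * sin (t / 2) ^ 2)) by ring.
  rewrite Rabs_Ropp, Rabs_pos_eq; [lra|].
  pose proof (pow2_ge_0 (sin (t / 2))); lra.
Qed.

Lemma Rabs_sin_sub_id_le (t : R) :
  Rabs t <= 1 -> Rabs (sin t - t) <= t ^ 2.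
Proof.
  intros Ht.
  replace (sin t - t) with ((sin t - t) - (sin 0 - 0)) by (rewrite sin_0; ring).
  replace (t ^ 2) with (Rabs t * Rabs (t - 0))
    by (rewrite Rminus_0_r, <- Rabs_mult, Rabs_pos_eq; [ring|nra]).
  apply bounded_variation with
    (h := fun u => sin u - u) (dh := fun u => cos u - 1).
  intros u Hu; rewrite !Rminus_0_r in Hu; split.
  - auto_derive; [exact I|ring].
  - eapply Rle_trans; [apply Rabs_cos_sub_1_le|].
    rewrite <- pow2_abs; pose proof (Rabs_pos u); nra.
Qed.

Lemma Cexp_plus (z w : C) : Cexp (z + w) = (Cexp z * Cexp w)%C.
Proof.
  unfold Cexp, Re, Im; destruct z as [a b], w as [c d]; simpl.
  rewrite exp_plus, cos_plus, sin_plus.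
  unfold Cmult, Cplus, RtoC, Ci; simpl. f_equal; ring.
Qed.

Lemma Cexp_RtoC (x : R) : Cexp (RtoC x) = RtoC (exp x).
Proof.
  unfold Cexp; rewrite re_RtoC, im_RtoC, cos_0, sin_0; ring.
Qed.

Lemma Cmod_le_Rabs (z : C) : Cmod z <= Rabs (Re z) + Rabs (Im z).
Proof.
  assert (E : z = (RtoC (Re z) + Ci * RtoC (Im z))%C)
    by (destruct z; unfold Cmult, Cplus, RtoC, Ci; simpl; f_equal; ring).
  rewrite E at 1. eapply Rle_trans; [apply Cmod_triangle|].
  rewrite Cmod_mult, Cmod_Ci, !Cmod_R; lra.
Qed.

Lemma Cexp_expansion (w : C) :
  Cmod w <= 1 / 2 -> Cmod (Cexp w - 1 - w) <= 4 * Cmod w ^ 2.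
Proof.
  intros Hw. rewrite Cmod2_alt.
  destruct w as [x y].
  assert (Hx := re_le_Cmod (x, y)).
  assert (Hy : Rabs y <= Cmod (x, y))
    by exact (Rle_trans _ _ _ (Rmax_r _ _) (Rmax_Cmod (x, y))).
  change (Re (x, y)) with x in *; change (Im (x, y)) with y.
  assert (Hx' : Rabs x <= 1 / 2) by lra.
  assert (He := exp_expansion_le x Hx').
  assert (Hc := Rabs_cos_sub_1_le y).
  assert (Hs := Rabs_sin_sub_id_le y ltac:(lra)).
  apply Rabs_le_between in Hx'. apply Rabs_le_between in He.
  assert (Hp := exp_pos x). assert (Hp2 : exp x <= 2) by nra.
  assert (Hp1 : Rabs (y * (exp x - 1)) <= x ^ 2 + y ^ 2).
  { assert (Hq : Rabs (exp x - 1) <= 2 * Rabs x).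
    { assert (x ^ 2 <= 1 / 2 * Rabs x).
      { rewrite <- (pow2_abs x). assert (Rabs x <= 1 / 2) by now apply Rabs_le.
        pose proof (Rabs_pos x); nra. }
      replace (exp x - 1) with ((exp x - 1 - x) + x) by ring.
      eapply Rle_trans; [apply Rabs_triang|].
      rewrite (Rabs_pos_eq (exp x - 1 - x)); [lra|].
      pose proof (exp_ineq1_le x); lra. }
    rewrite Rabs_mult, <- (pow2_abs x), <- (pow2_abs y).
    pose proof (Rabs_pos x); pose proof (Rabs_pos y).
    pose proof (pow2_ge_0 (Rabs x - Rabs y)); nra. }
  eapply Rle_trans; [apply Cmod_le_Rabs|].
  replace (Re (Cexp (x, y) - 1 - (x, y)))
    with (exp x * (cos y - 1) + (exp x - 1 - x))
    by (unfold Cexp, Re, Im, Cminus, Copp, Cmult, Cplus, RtoC, Ci; simpl; ring).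
  replace (Im (Cexp (x, y) - 1 - (x, y)))
    with (exp x * (sin y - y) + y * (exp x - 1))
    by (unfold Cexp, Re, Im, Cminus, Copp, Cmult, Cplus, RtoC, Ci; simpl; ring).
  assert (A1 := Rabs_triang (exp x * (cos y - 1)) (exp x - 1 - x)).
  assert (A2 := Rabs_triang (exp x * (sin y - y)) (y * (exp x - 1))).
  rewrite !Rabs_mult, (Rabs_pos_eq (exp x)) in A1 by lra.
  rewrite (Rabs_mult (exp x)), (Rabs_pos_eq (exp x)) in A2 by lra.
  assert (A3 : Rabs (exp x - 1 - x) <= 2 * x ^ 2) by (apply Rabs_le; lra).
  pose proof (Rabs_pos (cos y - 1)); pose proof (Rabs_pos (sin y - y)).
  assert (exp x * Rabs (cos y - 1) <= 2 * (y ^ 2 / 2))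
    by (apply Rmult_le_compat; lra).
  assert (exp x * Rabs (sin y - y) <= 2 * y ^ 2)
    by (apply Rmult_le_compat; lra).
  lra.
Qed.

(** * Gauss's product for the Gamma function *)

(** As [ln 0] is 0 and [pred 0] is 0, the values at 0 and 1 are 0 and the
    telescoping sum below is exact for every n. *)
Definition log_incr (j : nat) : R := ln (INR j) - ln (INR (pred j)).

Lemma ln_0 : ln 0 = 0.
Proof. unfold ln; destruct (Rlt_dec 0 0); [exfalso; lra|reflexivity]. Qed.

Lemma ln_eq_Rsum_log_incr n : ln (INR n) = Rsum log_incr n.
Proof.
  induction n as [|n IH].
  - rewrite sum_O; unfold log_incr; simpl; rewrite ln_0; ring.
  - rewrite Rsum_S, <- IH; unfold log_incr; simpl pred; ring.
Qed.

(** For j >= 2, 1/j <= ln j - ln (j-1) <= 1/(j-1).  The constant 6 is sharp enough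
    for 1/(j-1) - 1/(j+1) <= 6/(j+1)^2 at j = 2, where equality holds. *)
Lemma log_incr_sub_le (j : nat) :
  Rabs (log_incr j - / INR (S j)) <= 6 / INR (S j) ^ 2.
Proof.
  unfold log_incr; destruct j as [|[|j]].
  - simpl; rewrite ln_0.
    replace (0 - 0 - / 1) with (- (1)) by field.
    rewrite Rabs_Ropp, Rabs_R1; lra.
  - simpl; rewrite ln_0, ln_1.
    replace (0 - 0 - / (1 + 1)) with (- (1 / 2)) by field.
    rewrite Rabs_Ropp, Rabs_pos_eq; lra.
  - simpl pred. rewrite !S_INR.
    set (x := INR j). assert (Hx : 0 <= x) by apply pos_INR.
    assert (L : forall a b, 0 < a -> 0 < b -> ln a - ln b <= a / b - 1).
    { intros a b Ha Hb.
      replace (ln a - ln b) with (ln (a / b))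
        by (unfold Rdiv; rewrite ln_mult, ln_Rinv; auto using Rinv_0_lt_compat; ring).
      rewrite <- (exp_ln (a / b)) at 2 by (now apply Rdiv_lt_0_compat).
      pose proof (exp_ineq1_le (ln (a / b))); lra. }
    assert (L1 := L (x + 1 + 1) (x + 1) ltac:(lra) ltac:(lra)).
    assert (L2 := L (x + 1) (x + 1 + 1) ltac:(lra) ltac:(lra)).
    assert (E1 : (x + 1 + 1) / (x + 1) - 1 = / (x + 1)) by (field; lra).
    assert (E2 : (x + 1) / (x + 1 + 1) - 1 = - / (x + 1 + 1)) by (field; lra).
    assert (I1 : / (x + 1 + 1 + 1) <= / (x + 1 + 1))
      by (apply Rinv_le_contravar; lra).
    assert (I2 : / (x + 1) - / (x + 1 + 1 + 1) <= 6 / (x + 1 + 1 + 1) ^ 2).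
    { apply Rminus_le_0.
      replace (6 / (x + 1 + 1 + 1) ^ 2 - (/ (x + 1) - / (x + 1 + 1 + 1)))
        with (4 * x / ((x + 1) * (x + 1 + 1 + 1) ^ 2)) by (field; lra).
      apply Rdiv_le_0_compat; [lra|].
      apply Rmult_lt_0_compat; [lra|apply pow_lt; lra]. }
    rewrite Rabs_pos_eq; lra.
Qed.

(** The uniform lower bound, rather than mere non-vanishing, is what every
    estimate uses; it survives a small perturbation of z. *)
Definition off_poles (z : C) : Prop :=
  exists delta : R, 0 < delta /\ forall j, delta <= Cmod (z + RtoC (INR j)).

Lemma off_poles_neq_0 (z : C) (j : nat) :
  off_poles z -> (z + RtoC (INR j) <> 0)%C.
Proof.
  intros (delta & Hd & H); apply Cmod_gt_0; specialize (H j); lra.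
Qed.

Lemma off_poles_1 : off_poles 1%C.
Proof.
  exists 1; split; [lra|intros j].
  rewrite <- RtoC_plus, Cmod_R, Rabs_pos_eq; pose proof (pos_INR j); lra.
Qed.

Lemma off_poles_Im (z : C) : Im z <> 0 -> off_poles z.
Proof.
  intros H; exists (Rabs (Im z)); split; [now apply Rabs_pos_lt|intros j].
  replace (Im z) with (snd (z + RtoC (INR j))%C) by (simpl; unfold Im; ring).
  exact (Rle_trans _ _ _ (Rmax_r _ _) (Rmax_Cmod (z + RtoC (INR j))%C)).
Qed.

Lemma off_poles_near (z : C) :
  off_poles z ->
  exists rho, 0 < rho /\ forall h, Cmod h <= rho -> off_poles (z + h).
Proof.
  intros (delta & Hd & H); exists (delta / 2); split; [lra|intros h Hh].
  exists (delta / 2); split; [lra|intros j].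
  specialize (H j).
  pose proof (Cmod_triangle (z + h + RtoC (INR j)) (- h)) as T.
  replace (z + h + RtoC (INR j) + - h)%C with (z + RtoC (INR j))%C in T by ring.
  rewrite Cmod_opp in T; lra.
Qed.

(** Both c_j and 1/(z+j) are within O(1/(j+1)^2) of 1/(j+1).  For the second,
    j + 1 = (z + j) + (1 - z) is at most a constant times |z + j|, since |z + j|
    is bounded below. *)
Lemma pole_increment_bounds (z : C) :
  off_poles z ->
  exists K, 0 < K /\ forall j,
    let d := (/ (z + RtoC (INR j)))%C in
    Cmod (RtoC (log_incr j)) <= K / INR (S j) /\
    Cmod d <= K / INR (S j) /\
    Cmod (RtoC (log_incr j) - d) <= K / INR (S j) ^ 2.
Proof.
  intros (delta & Hd & H).
  set (e := Cmod (1 - z)). assert (He : 0 <= e) by apply Cmod_ge_0.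
  set (A := 1 + e / delta).
  assert (HA : 1 <= A).
  { unfold A. assert (0 <= e / delta) by now apply Rdiv_le_0_compat. lra. }
  exists (7 + A * (1 + e)). split; [nra|intros j d].
  set (s := INR (S j)).
  assert (Hs : 1 <= s) by (unfold s; rewrite S_INR; pose proof (pos_INR j); lra).
  set (w := (z + RtoC (INR j))%C) in *.
  assert (Hw : delta <= Cmod w) by apply H.
  assert (Hw0 : w <> 0%C) by (apply Cmod_gt_0; lra).
  assert (Hsw : RtoC s = (w + (1 - z))%C)
    by (unfold s, w; rewrite S_INR, RtoC_plus; ring).
  assert (Hs0 : RtoC s <> 0%C) by (apply Cmod_gt_0; rewrite Cmod_R, Rabs_pos_eq; lra).
  assert (Hs_le : s <= A * Cmod w).
  { pose proof (Cmod_triangle w (1 - z)) as T.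
    rewrite <- Hsw, Cmod_R, Rabs_pos_eq in T by lra. fold e in T.
    assert (e <= e / delta * Cmod w).
    { replace e with (e / delta * delta) at 1 by (field; lra).
      apply Rmult_le_compat_l; [now apply Rdiv_le_0_compat|exact Hw]. }
    unfold A; lra. }
  assert (Hd_le : Cmod d <= A / s).
  { unfold d; rewrite Cmod_inv by exact Hw0.
    apply Rle_div_r; [lra|].
    apply Rmult_le_reg_l with (Cmod w); [lra|].
    rewrite <- Rmult_assoc, Rinv_r by lra. lra. }
  assert (Hdiff : Cmod (RtoC (/ s) - d) <= e * A / s ^ 2).
  { unfold d; rewrite RtoC_inv by lra.
    replace (/ RtoC s - / w)%C with (- (1 - z) * / RtoC s * / w)%C
      by (rewrite Hsw in *; field; auto).
    rewrite !Cmod_mult, Cmod_opp; fold e d.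
    rewrite Cmod_inv, Cmod_R, (Rabs_pos_eq s) by (assumption || lra).
    replace (e * A / s ^ 2) with (e * / s * (A / s)) by (field; lra).
    apply Rmult_le_compat_l; [|exact Hd_le].
    apply Rmult_le_pos; [exact He|left; apply Rinv_0_lt_compat; lra]. }
  assert (Hc := log_incr_sub_le j). fold s in Hc.
  assert (Hss : 6 / s ^ 2 <= 6 / s).
  { apply Rmult_le_compat_l; [lra|].
    apply Rinv_le_contravar; [lra|nra]. }
  split; [|split].
  - rewrite Cmod_R.
    replace (log_incr j) with ((log_incr j - / s) + / s) by ring.
    eapply Rle_trans; [apply Rabs_triang|].
    rewrite (Rabs_pos_eq (/ s)) by (left; apply Rinv_0_lt_compat; lra).
    apply Rle_trans with (7 / s); [unfold Rdiv in *; lra|].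
    apply Rmult_le_compat_r; [left; apply Rinv_0_lt_compat; lra|nra].
  - eapply Rle_trans; [exact Hd_le|].
    apply Rmult_le_compat_r; [left; apply Rinv_0_lt_compat; lra|nra].
  - replace (RtoC (log_incr j) - d)%C
      with (RtoC (log_incr j - / s) + (RtoC (/ s) - d))%C
      by (rewrite RtoC_minus; ring).
    eapply Rle_trans; [apply Cmod_triangle|]. rewrite Cmod_R.
    apply Rle_trans with (6 / s ^ 2 + e * A / s ^ 2); [lra|].
    rewrite <- Rdiv_plus_distr.
    apply Rmult_le_compat_r; [left; apply Rinv_0_lt_compat, pow_lt; lra|nra].
Qed.

(** The j-th factor of G_n(z+h) / G_n(z); see [gauss_shift]. *)
Definition gauss_factor (z h : C) (j : nat) : C :=
  (Cexp (h * RtoC (log_incr j)) / (1 + h * / (z + RtoC (INR j))))%C.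

(** With the denominator cleared, the error is
    (exp(hc) - 1 - hc) - h^2 d (c - d): the terms h d cancel, and both parts are
    of second order in h. *)
Lemma gauss_factor_expansion (c : R) (d h : C) :
  Cmod h * Cmod (RtoC c) <= 1 / 2 -> Cmod h * Cmod d <= 1 / 2 ->
  Cmod (Cexp (h * RtoC c) / (1 + h * d) - 1 - h * (RtoC c - d)) <=
  2 * Cmod h ^ 2 * (4 * Cmod (RtoC c) ^ 2 + Cmod d * Cmod (RtoC c - d)).
Proof.
  rewrite <- !Cmod_mult; intros Hc Hd.
  assert (H1 : 1 / 2 <= Cmod (1 + h * d)).
  { pose proof (Cmod_triangle (1 + h * d) (- (h * d))) as T.
    replace (1 + h * d + - (h * d))%C with (RtoC 1) in T by ring.
    rewrite Cmod_1, Cmod_opp in T; lra. }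
  assert (H0 : (1 + h * d <> 0)%C) by (apply Cmod_gt_0; lra).
  replace (Cexp (h * RtoC c) / (1 + h * d) - 1 - h * (RtoC c - d))%C
    with (((Cexp (h * RtoC c) - 1 - h * RtoC c) - h ^ 2 * (d * (RtoC c - d)))
            / (1 + h * d))%C by (field; exact H0).
  rewrite Cmod_div by exact H0. apply Rle_div_l; [lra|].
  assert (T := Cmod_triangle (Cexp (h * RtoC c) - 1 - h * RtoC c)
                 (- (h ^ 2 * (d * (RtoC c - d))))).
  rewrite Cmod_opp in T. assert (E := Cexp_expansion _ Hc).
  rewrite !Cmod_mult in *. rewrite Cmod_pow in T.
  set (u := Cmod d * Cmod (RtoC c - d)) in *.
  assert (0 <= u) by (apply Rmult_le_pos; apply Cmod_ge_0).
  eapply Rle_trans; [exact T|].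
  assert (0 <= 4 * Cmod (RtoC c) ^ 2 + u)
    by (pose proof (pow2_ge_0 (Cmod (RtoC c))); lra).
  assert (0 <= Cmod h ^ 2 * (4 * Cmod (RtoC c) ^ 2 + u))
    by (apply Rmult_le_pos; [apply pow2_ge_0|assumption]).
  nra.
Qed.

(** The condition K |h| <= j + 1 covers two uses: all j at once when |h| <= 1/K,
    and all large j when h is arbitrary. *)
Lemma gauss_factor_bound (z : C) :
  off_poles z ->
  exists K, 0 < K /\ forall h j, K * Cmod h <= INR (S j) ->
    Cmod (gauss_factor z h j - 1
          - h * (RtoC (log_incr j) - / (z + RtoC (INR j)))) <=
      K * Cmod h ^ 2 / INR (S j) ^ 2 /\
    Cmod (RtoC (log_incr j) - / (z + RtoC (INR j))) <= K / INR (S j) ^ 2.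
Proof.
  intros Hz; destruct (pole_increment_bounds z Hz) as (K & HK & B).
  exists (2 * K + 10 * K ^ 2). split; [nra|intros h j Hh].
  destruct (B j) as (Bc & Bd & Be); clear B.
  set (s := INR (S j)) in *.
  assert (Hs : 1 <= s) by (unfold s; rewrite S_INR; pose proof (pos_INR j); lra).
  assert (Hi : 0 < / s) by (apply Rinv_0_lt_compat; lra).
  assert (Hi2 : 0 < / s ^ 2) by (apply Rinv_0_lt_compat, pow_lt; lra).
  set (d := (/ (z + RtoC (INR j)))%C) in *.
  assert (Hh0 := Cmod_ge_0 h).
  assert (Hsmall : Cmod h * (K / s) <= 1 / 2).
  { replace (Cmod h * (K / s)) with ((K * Cmod h) / s) by (field; lra).
    apply Rle_div_l; [lra|].
    assert (0 <= K ^ 2 * Cmod h) by (apply Rmult_le_pos; [apply pow2_ge_0|lra]).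
    lra. }
  split.
  - unfold gauss_factor; fold d.
    eapply Rle_trans; [apply gauss_factor_expansion|].
    + eapply Rle_trans; [apply Rmult_le_compat_l; [exact Hh0|exact Bc]|exact Hsmall].
    + eapply Rle_trans; [apply Rmult_le_compat_l; [exact Hh0|exact Bd]|exact Hsmall].
    + apply Rle_trans with (2 * Cmod h ^ 2 * (5 * (K / s) ^ 2)).
      * apply Rmult_le_compat_l; [pose proof (pow2_ge_0 (Cmod h)); lra|].
        assert (Be' : Cmod (RtoC (log_incr j) - d) <= K / s).
        { eapply Rle_trans; [exact Be|].
          apply Rmult_le_compat_l; [lra|apply Rinv_le_contravar; nra]. }
        assert (P1 := pow_incr _ _ 2 (conj (Cmod_ge_0 _) Bc)).
        assert (P2 := Rmult_le_compat _ _ _ _ (Cmod_ge_0 _) (Cmod_ge_0 _) Bd Be').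
        nra.
      * replace (2 * Cmod h ^ 2 * (5 * (K / s) ^ 2))
          with (10 * K ^ 2 * (Cmod h ^ 2 * / s ^ 2)) by (field; lra).
        unfold Rdiv; rewrite (Rmult_assoc _ (Cmod h ^ 2)).
        apply Rmult_le_compat_r; [|nra].
        apply Rmult_le_pos; [apply pow2_ge_0|lra].
  - eapply Rle_trans; [exact Be|].
    apply Rmult_le_compat_r; [lra|nra].
Qed.

Lemma is_lim_seq_inv_INR_S : is_lim_seq (fun n => / INR (S n)) 0.
Proof.
  apply (is_lim_seq_incr_1 (fun n => / INR n)).
  change (Finite 0) with (Rbar_inv p_infty).
  apply is_lim_seq_inv; [apply is_lim_seq_INR|discriminate].
Qed.

Lemma ex_series_inv_sq : ex_series (fun j => / INR (S j) ^ 2).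
Proof.
  apply (ex_series_le (V := R_CompleteNormedModule) _
           (fun j => 2 * (/ INR (S j) - / INR (S (S j))))).
  - intros j. change (norm (/ INR (S j) ^ 2)) with (Rabs (/ INR (S j) ^ 2)).
    rewrite (S_INR (S j)). set (s := INR (S j)).
    assert (Hs : 1 <= s) by (unfold s; rewrite S_INR; pose proof (pos_INR j); lra).
    rewrite Rabs_pos_eq by (left; apply Rinv_0_lt_compat, pow_lt; lra).
    apply Rminus_le_0.
    replace (2 * (/ s - / (s + 1)) - / s ^ 2)
      with ((s - 1) / (s ^ 2 * (s + 1))) by (field; lra).
    apply Rdiv_le_0_compat; [lra|].
    apply Rmult_lt_0_compat; [apply pow_lt|]; lra.
  - exists 2.
    change (is_lim_seq (Rsum (fun j => 2 * (/ INR (S j) - / INR (S (S j))))) 2).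
    apply (is_lim_seq_ext (fun n => 2 - 2 * / INR (S (S n)))).
    + induction n as [|n IH]; [rewrite sum_O; simpl; field|].
      rewrite (Rsum_S _ n), <- IH; ring.
    + replace (Finite 2) with (Finite (2 - 2 * 0)) by (f_equal; ring).
      apply is_lim_seq_minus'; [apply is_lim_seq_const|].
      apply is_lim_seq_mult'; [apply is_lim_seq_const|].
      apply (is_lim_seq_incr_1 (fun n => / INR (S n))), is_lim_seq_inv_INR_S.
Qed.

(** The sequence whose limit defines [CGamma]. *)
Definition gauss (z : C) (n : nat) : C :=
  (RtoC (INR (fact n)) * Rcpow (INR n) z / rising z (S n))%C.

Lemma rising_neq_0 (z : C) n : off_poles z -> rising z n <> 0%C.
Proof.
  intros Hz; induction n as [|n IH]; [exact C1_nz|].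
  now apply Cmult_neq_0, off_poles_neq_0.
Qed.

Lemma Cexp_neq_0 (z : C) : Cexp z <> 0%C.
Proof.
  intros H. apply C1_nz.
  rewrite <- exp_0, <- Cexp_RtoC.
  replace (RtoC 0) with (z + - z)%C by ring.
  rewrite Cexp_plus, H; ring.
Qed.

(** The exponentials multiply to n^h because the increments of the logarithm sum
    to ln n, and each denominator is (z+h+j) / (z+j). *)
Lemma gauss_shift (z h : C) n :
  off_poles z -> off_poles (z + h) ->
  gauss (z + h) n = (gauss z n * Cprod (gauss_factor z h) n)%C.
Proof.
  intros Hz Hzh.
  assert (E : Rcpow (INR n) (z + h)
    = (Rcpow (INR n) z * Cprod (fun j => Cexp (h * RtoC (log_incr j))) n)%C).
  { unfold Rcpow. rewrite Cmult_plus_distr_r, Cexp_plus. f_equal.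
    rewrite ln_eq_Rsum_log_incr.
    induction n as [|n IH]; [now rewrite sum_O|].
    cbn [Cprod]; rewrite Rsum_S, RtoC_plus, <- IH, <- Cexp_plus; f_equal; apply Cmult_plus_distr_l. }
  unfold gauss; rewrite E.
  assert (D : (rising z (S n)
    = rising (z + h) (S n) * Cprod (fun j => / (1 + h * / (z + RtoC (INR j)))) n)%C).
  { assert (S1 : forall j, (z + RtoC (INR j) = (z + h + RtoC (INR j))
                    * / (1 + h * / (z + RtoC (INR j))))%C).
    { intros j; assert (Hj := off_poles_neq_0 _ j Hz).
      assert (Hj' := off_poles_neq_0 _ j Hzh).
      field; split; [exact Hj|].
      now replace (z + RtoC (INR j) + h)%C with (z + h + RtoC (INR j))%C by ring. }
    clear E; induction n as [|n IH].
    - cbn [Cprod rising]; rewrite (S1 O) at 1; ring.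
    - change (rising z (S (S n))) with (rising z (S n) * (z + RtoC (INR (S n))))%C.
      change (rising (z + h) (S (S n)))
        with (rising (z + h) (S n) * (z + h + RtoC (INR (S n))))%C.
      rewrite IH, (S1 (S n)) at 1; cbn [Cprod]; ring. }
  assert (R0 := rising_neq_0 z (S n) Hz).
  assert (R1 := rising_neq_0 (z + h) (S n) Hzh).
  unfold gauss_factor, Cdiv at 3.
  rewrite Cprod_mult.
  set (Q := Cprod (fun j => / _)%C n) in *.
  rewrite D in R0 |- *.
  field. split; [intros H; apply R0; rewrite H; ring|exact R1].
Qed.

Lemma gauss_factor_neq_0 (z h : C) j :
  off_poles z -> off_poles (z + h) -> gauss_factor z h j <> 0%C.
Proof.
  intros Hz Hzh; unfold gauss_factor.
  assert (Hj := off_poles_neq_0 _ j Hz); assert (Hj' := off_poles_neq_0 _ j Hzh).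
  intros H; apply (Cexp_neq_0 (h * RtoC (log_incr j))).
  assert (N : (1 + h * / (z + RtoC (INR j)) <> 0)%C).
  { replace (1 + h * / (z + RtoC (INR j)))%C
      with ((z + h + RtoC (INR j)) * / (z + RtoC (INR j)))%C by (field; exact Hj).
    apply Cmult_neq_0; [exact Hj'|].
    intros H0; apply Hj; rewrite <- (Cmult_1_r (z + _)), <- (Cinv_r _ Hj), H0; ring. }
  set (X := Cexp _) in *; set (Y := (1 + _)%C) in *.
  replace X with (X / Y * Y)%C by (field; exact N).
  rewrite H; ring.
Qed.

Lemma gauss_factor_summable (z h : C) :
  off_poles z -> ex_series (fun j => Cmod (gauss_factor z h j - 1)).
Proof.
  intros Hz; destruct (gauss_factor_bound z Hz) as (K & HK & B).
  destruct (nfloor_ex (K * Cmod h)) as [N [_ HN]];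
    [apply Rmult_le_pos; [lra|apply Cmod_ge_0]|].
  apply (ex_series_incr_n (V := R_NormedModule) _ N).
  apply (ex_series_le (V := R_CompleteNormedModule) _
    (fun n => (K * Cmod h ^ 2 + K * Cmod h) * / INR (S (N + n)) ^ 2)).
  - intros n.
    destruct (B h (N + n)%nat) as [B1 B2].
    { rewrite S_INR, plus_INR; pose proof (pos_INR n); lra. }
    change (Rabs (Cmod (gauss_factor z h (N + n) - 1)) <=
      (K * Cmod h ^ 2 + K * Cmod h) * / INR (S (N + n)) ^ 2).
    rewrite Rabs_pos_eq by apply Cmod_ge_0.
    set (f := gauss_factor z h (N + n)) in *.
    set (a := (RtoC (log_incr (N + n)) - / (z + RtoC (INR (N + n))))%C) in *.
    replace (f - 1)%C with ((f - 1 - h * a) + h * a)%C by ring.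
    eapply Rle_trans; [apply Cmod_triangle|].
    rewrite Cmod_mult, Rmult_plus_distr_r.
    apply Rplus_le_compat; [exact B1|].
    rewrite (Rmult_comm K), Rmult_assoc.
    apply Rmult_le_compat_l; [apply Cmod_ge_0|exact B2].
  - apply (ex_series_scal (V := R_NormedModule)).
    apply (ex_series_incr_n (V := R_NormedModule) (fun n => / INR (S n) ^ 2) N).
    exact ex_series_inv_sq.
Qed.

Lemma gauss_factor_prod_converges (z h : C) :
  off_poles z -> exists P, converges (Cprod (gauss_factor z h)) P /\
    (off_poles (z + h) -> P <> 0%C).
Proof.
  intros Hz.
  assert (E : forall j, gauss_factor z h j = (1 + (gauss_factor z h j - 1))%C)
    by (intros j; ring).
  destruct (Cprod_converges _ (gauss_factor_summable z h Hz)) as [P HP].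
  exists P; split.
  - apply converges_ext with (2 := HP); intros n; apply Cprod_ext.
    intros j; now rewrite <- E.
  - intros Hzh.
    apply (Cprod_limit_neq_0 _ _ (gauss_factor_summable z h Hz)); [|exact HP].
    intros j; rewrite <- E; now apply gauss_factor_neq_0.
Qed.

Lemma gauss_1_converges : converges (gauss 1) 1.
Proof.
  apply converges_le with (fun n => / INR (S n)).
  - exists 1%nat; intros n Hn.
    assert (Hn0 : 0 < INR n) by (apply lt_0_INR; lia).
    unfold gauss, Rcpow. rewrite Cmult_1_l, Cexp_RtoC, exp_ln by exact Hn0.
    assert (R : forall m, rising 1 m = RtoC (INR (fact m))).
    { induction m as [|m IH]; [reflexivity|].
      cbn [rising]; rewrite IH, fact_simpl, mult_INR, S_INR, RtoC_mult, RtoC_plus.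
      ring. }
    rewrite R, fact_simpl, mult_INR, <- RtoC_mult.
    assert (Hf := INR_fact_lt_0 n).
    rewrite S_INR, <- RtoC_div by nra. rewrite <- RtoC_minus, Cmod_R.
    replace (INR (fact n) * INR n / ((INR n + 1) * INR (fact n)) - 1)
      with (- / (INR n + 1)) by (field; lra).
    rewrite Rabs_Ropp, Rabs_pos_eq; [apply Rle_refl|].
    left; apply Rinv_0_lt_compat; lra.
  - exact is_lim_seq_inv_INR_S.
Qed.

(** Every z is reached from 1 by a single, possibly large, shift. *)
Lemma gauss_converges (z : C) :
  off_poles z -> converges (gauss z) (CGamma z) /\ CGamma z <> 0%C.
Proof.
  intros Hz.
  destruct (gauss_factor_prod_converges 1 (z - 1) off_poles_1) as (P & HP & P0).
  assert (Ez : (1 + (z - 1) = z)%C) by ring. rewrite Ez in P0.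
  assert (L : converges (gauss z) P).
  { rewrite <- (Cmult_1_l P).
    apply converges_ext with (2 := converges_mult _ _ _ _ gauss_1_converges HP).
    intros n; rewrite <- (gauss_shift 1 (z - 1) n off_poles_1); now rewrite Ez. }
  assert (E : CGamma z = P) by exact (Clim_seq_converges _ _ L).
  rewrite E; auto.
Qed.

Lemma is_derive_of_quadratic_error (f : C -> C) (z l : C) (rho M : R) :
  0 < rho -> 0 <= M ->
  (forall h, Cmod h <= rho -> Cmod (f (z + h) - f z - h * l)%C <= M * Cmod h ^ 2) ->
  is_derive (K := C_AbsRing) (V := C_NormedModule) f z l.
Proof.
  intros Hrho HM H; split; [apply is_linear_scal_l|].
  intros x Hx. apply (is_filter_lim_locally_unique
    (V := AbsRing_NormedModule C_AbsRing)) in Hx; subst x.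
  intros eps.
  assert (Hd : 0 < Rmin rho (eps / (M + 1))).
  { apply Rmin_pos; [exact Hrho|].
    apply Rdiv_lt_0_compat; [apply cond_pos|lra]. }
  exists (mkposreal _ Hd); intros y Hy.
  change (Cmod (y - z) < Rmin rho (eps / (M + 1))) in Hy.
  change (Cmod ((f y - f z) - (y - z) * l) <= eps * Cmod (y - z)).
  set (h := (y - z)%C) in *.
  replace y with (z + h)%C by (unfold h; ring).
  assert (H1 := Rmin_l rho (eps / (M + 1))).
  assert (H2 := Rmin_r rho (eps / (M + 1))).
  eapply Rle_trans; [apply H; lra|].
  assert (H3 : (M + 1) * Cmod h <= eps).
  { rewrite Rmult_comm; apply Rle_div_r; lra. }
  pose proof (Cmod_ge_0 h); nra.
Qed.

(** The increments c_j - 1/(z+j) sum to L absolutely.  Uniformly in n, the product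
    of the gauss factors is 1 + h (sum of the increments) + O(|h|^2); in the limit
    this reads CGamma (z + h) = CGamma z (1 + h L + O(|h|^2)). *)
Lemma digamma_converges (z : C) :
  off_poles z ->
  converges (fun n => RtoC (ln (INR n)) - Csum (fun j => / (z + RtoC (INR j))) n)%C
            (digamma z).
Proof.
  intros Hz.
  destruct (gauss_factor_bound z Hz) as (K & HK & B).
  set (a := fun j => (RtoC (log_incr j) - / (z + RtoC (INR j)))%C).
  assert (Ha : forall j, Cmod (a j) <= K * / INR (S j) ^ 2).
  { intros j; destruct (B 0%C j) as [_ B0]; [|exact B0].
    rewrite Cmod_0; pose proof (pos_INR (S j)); lra. }
  destruct (ex_series_le_eventually a (fun j => K * / INR (S j) ^ 2)) as [L HL].
  { exists O; auto. }
  { apply (ex_series_scal (V := R_NormedModule)), ex_series_inv_sq. }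
  apply is_series_converges in HL.
  assert (HL' : converges
    (fun n => RtoC (ln (INR n)) - Csum (fun j => / (z + RtoC (INR j))) n)%C L).
  { apply converges_ext with (2 := HL); intros n.
    rewrite ln_eq_Rsum_log_incr, <- Csum_RtoC; apply Csum_minus. }
  destruct (gauss_converges z Hz) as [HG HG0].
  enough (HD : is_derive (K := C_AbsRing) (V := C_NormedModule)
                 CGamma z (CGamma z * L)%C).
  { replace (digamma z) with L; [exact HL'|].
    unfold digamma, Cderiv, Cthe.
    rewrite (iota_unique (V := C_CompleteNormedModule) _ (CGamma z * L)%C).
    - unfold Cdiv; rewrite (Cmult_comm (CGamma z)), <- Cmult_assoc.
      now rewrite Cinv_r, Cmult_1_r.
    - intros y Hy. rewrite <- (is_C_derive_unique _ _ _ Hy).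
      exact (is_C_derive_unique _ _ _ HD).
    - exact HD. }
  destruct (off_poles_near z Hz) as (rho & Hrho & Hnear).
  set (q := fun j => / INR (S j) ^ 2).
  assert (Hq : forall j, 0 <= q j).
  { intros j; left; apply Rinv_0_lt_compat, pow_lt, lt_0_INR; lia. }
  set (V := Series q).
  assert (HV : forall n, Rsum q n <= V)
    by (intros n; apply Rsum_le_Series; [exact Hq|exact ex_series_inv_sq]).
  assert (HS0 : 0 <= V) by exact (Rle_trans _ _ _ (Rsum_ge_0 q 0 Hq) (HV O)).
  set (M := 8 * K ^ 2 * V ^ 2 + K * V).
  assert (HM : 0 <= M) by (unfold M; pose proof (pow2_ge_0 (K * V)); nra).
  (* The radius keeps every factor within reach of the bounds, and the total
     variation 2 K V |h| of the factors below 1/2. *)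
  set (D := K + 4 * K * V + 1).
  assert (HD0 : 1 <= D) by (unfold D; nra).
  apply is_derive_of_quadratic_error
    with (rho := Rmin rho (/ D)) (M := Cmod (CGamma z) * M).
  - apply Rmin_pos; [exact Hrho|apply Rinv_0_lt_compat; lra].
  - apply Rmult_le_pos; [apply Cmod_ge_0|exact HM].
  - intros h Hh.
    assert (Hh1 : Cmod h <= rho) by (eapply Rle_trans; [exact Hh|apply Rmin_l]).
    assert (Hh2 : Cmod h * D <= 1).
    { apply Rle_div_r; [lra|]. unfold Rdiv; rewrite Rmult_1_l.
      eapply Rle_trans; [exact Hh|apply Rmin_r]. }
    assert (Hh0 := Cmod_ge_0 h). set (e := Cmod h) in *.
    assert (Hzh := Hnear h Hh1).
    destruct (gauss_factor_prod_converges z h Hz) as (P & HP & _).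
    assert (EG : CGamma (z + h) = (CGamma z * P)%C).
    { apply (converges_unique (gauss (z + h))); [now apply gauss_converges|].
      apply converges_ext with (2 := converges_mult _ _ _ _ HG HP).
      intros n; symmetry; now apply gauss_shift. }
    rewrite EG.
    replace (CGamma z * P - CGamma z - h * (CGamma z * L))%C
      with (CGamma z * (P + - (1) + - h * L - 0))%C by ring.
    rewrite Cmod_mult, Rmult_assoc.
    apply Rmult_le_compat_l; [apply Cmod_ge_0|].
    apply converges_Cmod_le
      with (fun n => Cprod (gauss_factor z h) n + - (1) + - h * Csum a n)%C.
    { apply converges_plus; [apply converges_plus;
        [exact HP|apply converges_const]|now apply converges_scal]. }
    intros n.
    set (x := fun j => (gauss_factor z h j - 1)%C).
    assert (Hx : forall j, Cmod (x j - h * a j) <= K * e ^ 2 * q j).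
    { intros j; apply (B h j). fold e.
      apply Rle_trans with 1; [unfold D in Hh2; nra|].
      rewrite S_INR; pose proof (pos_INR j); lra. }
    assert (Hx' : forall j, Cmod (x j) <= 2 * K * e * q j).
    { intros j. replace (x j) with ((x j - h * a j) + h * a j)%C by ring.
      eapply Rle_trans; [apply Cmod_triangle|]. rewrite Cmod_mult; fold e.
      specialize (Hx j); specialize (Ha j); fold (q j) in Ha; specialize (Hq j).
      assert (e * Cmod (a j) <= e * (K * q j)) by now apply Rmult_le_compat_l.
      assert (e <= 1) by nra.
      assert (0 <= K * e * q j) by (repeat apply Rmult_le_pos; lra).
      nra. }
    rewrite (Cprod_ext _ (fun j => 1 + x j)%C) by (intros j; unfold x; ring).
    destruct (Cprod_expansion x n) as [_ X]; cbn zeta in X.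
    set (t := Rsum (fun j => Cmod (x j)) n) in *.
    assert (Ht0 : 0 <= t) by (apply Rsum_ge_0; intros; apply Cmod_ge_0).
    assert (Ht : t <= 2 * K * e * V).
    { apply Rle_trans with (2 * K * e * Rsum q n).
      - rewrite <- Rsum_scal; now apply Rsum_le.
      - apply Rmult_le_compat_l; [nra|apply HV]. }
    assert (Ht' : t <= 1 / 2) by (unfold D in Hh2; nra).
    assert (Et := exp_expansion_le t).
    rewrite (Rabs_pos_eq t) in Et by lra.
    rewrite Rabs_pos_eq in Et by (pose proof (exp_ineq1_le t); lra).
    specialize (Et Ht').
    assert (Y : Cmod (Csum x n - h * Csum a n) <= K * e ^ 2 * V).
    { replace (Csum x n - h * Csum a n)%C with (Csum (fun j => x j - h * a j)%C n).
      - eapply Rle_trans; [apply Cmod_Csum_le|].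
        apply Rle_trans with (K * e ^ 2 * Rsum q n).
        + rewrite <- Rsum_scal; now apply Rsum_le.
        + apply Rmult_le_compat_l; [|apply HV].
          apply Rmult_le_pos; [lra|apply pow2_ge_0].
      - rewrite <- Csum_scal; apply Csum_minus. }
    set (Pn := Cprod _ n) in *.
    replace (Pn + - (1) + - h * Csum a n - 0)%C
      with ((Pn - 1 - Csum x n) + (Csum x n - h * Csum a n))%C by ring.
    eapply Rle_trans; [apply Cmod_triangle|].
    assert (t ^ 2 <= (2 * K * e * V) ^ 2) by (apply pow_incr; lra).
    unfold M; nra.
Qed.

(** * Sums over the 2k-th roots of -1 *)

Definition cis (t : R) : C := Cexp (Ci * RtoC t).

Lemma cis_eq (t : R) : cis t = (cos t, sin t).
Proof.
  unfold cis, Cexp. replace (Ci * RtoC t)%C with ((0, t) : C)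
    by (unfold Ci, Cmult, RtoC; simpl; f_equal; ring).
  unfold Re, Im; simpl fst; simpl snd; rewrite exp_0.
  unfold Ci, Cmult, Cplus, RtoC; simpl; f_equal; ring.
Qed.

Lemma cis_plus (s t : R) : cis (s + t) = (cis s * cis t)%C.
Proof.
  unfold cis; rewrite <- Cexp_plus, RtoC_plus; f_equal; ring.
Qed.

Lemma cis_pow (t : R) n : (cis t ^ n)%C = cis (INR n * t).
Proof.
  induction n as [|n IH].
  - simpl (INR 0); now rewrite Rmult_0_l, (cis_eq 0), cos_0, sin_0.
  - rewrite Cpow_S, IH, <- cis_plus, S_INR; f_equal; ring.
Qed.

Lemma cis_eq_1 (t : R) : cis t = 1%C -> sin (t / 2) = 0.
Proof.
  rewrite cis_eq; intros H; injection H as H _.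
  replace t with (2 * (t / 2)) in H by field.
  rewrite cos_2a_sin in H. nra.
Qed.

Lemma eps_cis k r :
  (1 <= k)%nat -> eps k r = cis ((2 * INR r + 1) * (PI / INR (2 * k))).
Proof.
  intros Hk. assert (Hk0 : 0 < INR k) by (apply lt_0_INR; lia).
  unfold eps, cis; f_equal.
  rewrite mult_INR; change (INR 2) with 2.
  unfold Rdiv. rewrite !RtoC_mult, !RtoC_plus, RtoC_mult, RtoC_inv by nra.
  rewrite RtoC_mult.
  field. apply Cmod_gt_0; rewrite Cmod_R, Rabs_pos_eq; lra.
Qed.

Lemma eps_pow_2k k r : (1 <= k)%nat -> (eps k r ^ (2 * k) = - (1))%C.
Proof.
  intros Hk. rewrite eps_cis, cis_pow by exact Hk.
  assert (Hk0 : 0 < INR (2 * k)) by (apply lt_0_INR; lia).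
  replace (INR (2 * k) * ((2 * INR r + 1) * (PI / INR (2 * k))))
    with (PI + 2 * INR r * PI) by (field; lra).
  rewrite cis_eq, cos_period, sin_period, cos_PI, sin_PI.
  unfold Copp, RtoC; simpl; f_equal; ring.
Qed.

(** The 2k-th power of a real number cannot be -1. *)
Lemma Im_eps_neq_0 k r : (1 <= k)%nat -> Im (eps k r) <> 0.
Proof.
  intros Hk H. assert (E := eps_pow_2k k r Hk).
  assert (Hr : eps k r = RtoC (Re (eps k r)))
    by (destruct (eps k r) as [x y]; unfold Im, Re in *; simpl in *; now subst y).
  rewrite Hr, <- RtoC_pow, <- RtoC_opp in E. apply (f_equal Re) in E.
  rewrite !re_RtoC, pow_mult in E.
  assert (0 <= (Re (eps k r) ^ 2) ^ k) by apply pow_le, pow2_ge_0. lra.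
Qed.

(** A geometric progression of ratio omega = exp(2 pi i q / 2k) that returns to its
    first term after 2k steps; omega <> 1 because pi q / 2k lies in (0, 2 pi) and
    is not pi. *)
Lemma sum_pow_eps k q :
  (1 <= k)%nat -> (0 < q < 4 * k)%nat -> q <> (2 * k)%nat ->
  Csum (fun r => eps k r ^ q)%C (2 * k - 1) = 0%C :> C.
Proof.
  intros Hk Hq Hq2.
  assert (Hk0 : 0 < INR (2 * k)) by (apply lt_0_INR; lia).
  set (alpha := PI / INR (2 * k)).
  set (omega := cis (INR q * (2 * alpha))).
  assert (Hstep : forall r, (eps k (S r) ^ q = omega * eps k r ^ q)%C).
  { intros r. rewrite !eps_cis, !cis_pow by exact Hk.
    unfold omega; rewrite <- cis_plus, S_INR; fold alpha; f_equal; ring. }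
  assert (Htel : forall N, ((omega - 1) * Csum (fun r => eps k r ^ q)%C N
                            = eps k (S N) ^ q - eps k 0 ^ q)%C).
  { induction N as [|N IH].
    - rewrite sum_O, Hstep; ring.
    - rewrite Csum_S, Cmult_plus_distr_l, IH, (Hstep (S N)); ring. }
  specialize (Htel (2 * k - 1)%nat).
  replace (S (2 * k - 1)) with (2 * k)%nat in Htel by lia.
  assert (Hper : eps k (2 * k) = eps k 0).
  { rewrite !eps_cis, !cis_eq by exact Hk; fold alpha.
    replace ((2 * INR (2 * k) + 1) * alpha)
      with ((2 * INR 0 + 1) * alpha + 2 * INR 1 * PI)
      by (unfold alpha; simpl (INR 0); simpl (INR 1); field; lra).
    now rewrite cos_period, sin_period. }
  rewrite Hper in Htel.
  assert (Hw : (omega - 1 <> 0)%C).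
  { intros H. apply Ceq_minus, cis_eq_1 in H.
    replace (INR q * (2 * alpha) / 2) with (INR q * alpha) in H by field.
    assert (HPI := PI_RGT_0).
    assert (Ha : 0 < alpha) by (apply Rdiv_lt_0_compat; lra).
    assert (Hpi : INR (2 * k) * alpha = PI) by (unfold alpha; field; lra).
    destruct (Nat.lt_gt_cases q (2 * k)) as [[Hlt|Hgt] _]; [exact Hq2| |].
    - apply lt_INR in Hlt. assert (0 < INR q) by (apply lt_0_INR; lia).
      enough (0 < sin (INR q * alpha)) by lra. apply sin_gt_0; nra.
    - assert (Hq4 : (q < 2 * (2 * k))%nat) by lia.
      apply lt_INR in Hgt; apply lt_INR in Hq4.
      rewrite (mult_INR 2 (2 * k)) in Hq4; simpl (INR 2) in Hq4.
      enough (sin (INR q * alpha) < 0) by lra. apply sin_lt_0; nra. }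
  set (X := Csum _ _) in *.
  replace X with (/ (omega - 1) * ((omega - 1) * X))%C by (field; exact Hw).
  rewrite Htel; ring.
Qed.

Lemma Csum_single (u : nat -> C) (i N : nat) :
  (i <= N)%nat -> (forall j, (j <= N)%nat -> j <> i -> u j = 0%C) ->
  Csum u N = u i :> C.
Proof.
  intros Hi H. induction N as [|N IH].
  - rewrite sum_O; f_equal; lia.
  - rewrite Csum_S. destruct (Nat.eq_dec i (S N)) as [->|Hne].
    + rewrite (Csum_ext _ (fun _ => 0 * 0)%C)
        by (intros j Hj; rewrite H by lia; ring).
      rewrite Csum_scal; ring.
    + rewrite IH, (H (S N)) by (lia || intros; apply H; lia); ring.
Qed.

Lemma Csum_geometric (x y : C) n :
  ((x - y) * Csum (fun j => x ^ (n - j) * y ^ j)%C n = x ^ S n - y ^ S n)%C.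
Proof.
  induction n as [|n IH].
  - rewrite sum_O; simpl; ring.
  - rewrite Csum_S.
    rewrite (Csum_ext _ (fun j => x * (x ^ (n - j) * y ^ j))%C).
    + rewrite Csum_scal, Nat.sub_diag.
      replace ((x - y) * (x * Csum (fun j => x ^ (n - j) * y ^ j) n
                 + x ^ 0 * y ^ S n))%C
        with (x * ((x - y) * Csum (fun j => x ^ (n - j) * y ^ j) n)
                 + (x - y) * y ^ S n)%C by (simpl; ring).
      rewrite IH, !Cpow_S; ring.
    + intros j Hj; rewrite Nat.sub_succ_l by exact Hj; rewrite Cpow_S; ring.
Qed.

Lemma Cpow_opp_1_even n : ((- (1)) ^ (2 * n) = 1)%C.
Proof.
  rewrite Cpow_mult_r.
  replace ((- (1)) ^ 2)%C with (RtoC 1) by (simpl; ring).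
  apply Cpow_1_l.
Qed.

Lemma RtoC_neq_0 (x : R) : x <> 0 -> RtoC x <> 0%C.
Proof. intros H E; apply H. now apply RtoC_inj. Qed.

(** Since eps^(2k) = -1, the geometric identity with x = m and y = - eps w turns
    1 / (eps w + m) into a polynomial in eps of degree 2k - 1 over
    m^(2k) + w^(2k).  After multiplication by eps^(l+1), the exponents run from
    l+1 to 2k+l, and summing over the roots keeps only the exponent 2k. *)
Lemma sum_eps_partial_fraction k l (w : R) (m : nat) :
  (1 <= l)%nat -> (l <= 2 * k - 2)%nat -> 0 < w ->
  Csum (fun r => eps k r ^ (l + 1) * / (eps k r * RtoC w + RtoC (INR m)))%C
       (2 * k - 1)
  = (- RtoC (INR (2 * k)) * (- (1)) ^ (2 * k - 1 - l)
     * RtoC (INR m ^ l * w ^ (2 * k - 1 - l)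
             / (INR m ^ (2 * k) + w ^ (2 * k))))%C :> C.
Proof.
  intros Hl1 Hl2 Hw. assert (Hk : (1 <= k)%nat) by lia.
  set (D := INR m ^ (2 * k) + w ^ (2 * k)).
  assert (HD : D <> 0).
  { assert (0 < w ^ (2 * k)) by now apply pow_lt.
    assert (0 <= INR m ^ (2 * k)) by apply pow_le, pos_INR. unfold D; lra. }
  (* The coefficient of eps^j in the polynomial for 1 / (eps w + m). *)
  set (v := fun j => (/ RtoC D * (RtoC (INR m) ^ (2 * k - 1 - j)
                                  * (- RtoC w) ^ j))%C).
  assert (E : forall r, (eps k r ^ (l + 1) * / (eps k r * RtoC w + RtoC (INR m))
    = Csum (fun j => v j * eps k r ^ (l + 1 + j)) (2 * k - 1))%C).
  { intros r. set (e := eps k r).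
    assert (He : (e * RtoC w + RtoC (INR m) <> 0)%C).
    { intros H. apply (f_equal Im) in H.
      replace (Im (e * RtoC w + RtoC (INR m))) with (Im e * w) in H
        by (unfold Im, Cmult, Cplus, RtoC; simpl; ring).
      rewrite im_RtoC in H. apply (Im_eps_neq_0 k r Hk). fold e. nra. }
    assert (G := Csum_geometric (RtoC (INR m)) (- (e * RtoC w)) (2 * k - 1)).
    replace (S (2 * k - 1)) with (2 * k)%nat in G by lia.
    replace ((- (e * RtoC w)) ^ (2 * k))%C with (- RtoC w ^ (2 * k))%C in G.
    2: { replace (- (e * RtoC w))%C with (- (1) * e * RtoC w)%C by ring.
         rewrite !Cpow_mult_l. unfold e; rewrite eps_pow_2k by exact Hk.
         rewrite Cpow_opp_1_even; ring. }
    replace (RtoC (INR m) ^ (2 * k) - - RtoC w ^ (2 * k))%C with (RtoC D) in G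
      by (unfold D; rewrite RtoC_plus, !RtoC_pow; ring).
    rewrite (Csum_ext _ (fun j => (e ^ (l + 1) * / RtoC D)
      * (RtoC (INR m) ^ (2 * k - 1 - j) * (- (e * RtoC w)) ^ j))%C).
    2: { intros j _; unfold v.
         replace (- (e * RtoC w))%C with (e * (- RtoC w))%C by ring.
         rewrite Cpow_mult_l, (Cpow_add_r e (l + 1)). ring. }
    rewrite Csum_scal. apply RtoC_neq_0 in HD.
    set (Sg := Csum _ _) in *.
    replace (RtoC (INR m) - - (e * RtoC w))%C
      with (e * RtoC w + RtoC (INR m))%C in G by ring.
    rewrite <- G in HD |- *.
    field; split; [|exact He].
    intros H; apply HD; rewrite H; ring. }
  rewrite (Csum_ext _ _ _ (fun r _ => E r)), sum_n_switch.
  rewrite (Csum_ext _ (fun j => v j * Csum (fun r => eps k r ^ (l + 1 + j))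
                                            (2 * k - 1)))%C
    by (intros j _; apply Csum_scal).
  rewrite (Csum_single _ (2 * k - 1 - l)).
  - rewrite (Csum_ext _ (fun _ => - (1) * 1)%C).
    2: { intros r _; replace (l + 1 + (2 * k - 1 - l))%nat with (2 * k)%nat by lia.
         rewrite eps_pow_2k by exact Hk; ring. }
    rewrite Csum_scal.
    replace (Csum (fun _ => RtoC 1) (2 * k - 1)) with (RtoC (INR (2 * k))).
    2: { rewrite (Csum_RtoC (fun _ => 1)), sum_n_const.
         replace (S (2 * k - 1)) with (2 * k)%nat by lia. f_equal; ring. }
    unfold v. replace (2 * k - 1 - (2 * k - 1 - l))%nat with l by lia.
    replace (- RtoC w)%C with (- (1) * RtoC w)%C by ring.
    unfold Rdiv.
    rewrite Cpow_mult_l, !RtoC_mult, RtoC_inv, !RtoC_pow by exact HD. ring.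
  - lia.
  - intros j Hj Hne. rewrite sum_pow_eps by lia. ring.
Qed.

Lemma b_converges k l (w : R) :
  (1 <= l)%nat -> (l <= 2 * k - 2)%nat -> 0 < w ->
  converges (fun n => RtoC (2 * Rsum (fun m => INR m ^ l * w ^ (2 * k - 1 - l)
                              / (INR m ^ (2 * k) + w ^ (2 * k))) n))
            (b k l w).
Proof.
  intros Hl1 Hl2 Hw. assert (Hk : (1 <= k)%nat) by lia.
  set (g := fun m => INR m ^ l * w ^ (2 * k - 1 - l)
                     / (INR m ^ (2 * k) + w ^ (2 * k))).
  unfold b.
  apply converges_ext with (fun n => (- (1)) ^ (l + 1) / RtoC (INR k) *
    Csum (fun r => eps k r ^ (l + 1) * (RtoC (ln (INR n)) -
            Csum (fun j => / (eps k r * RtoC w + RtoC (INR j))) n))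
         (2 * k - 1))%C.
  - intros n.
    rewrite (Csum_ext _ (fun r => RtoC (ln (INR n)) * eps k r ^ (l + 1) -
      Csum (fun j => eps k r ^ (l + 1)
              * / (eps k r * RtoC w + RtoC (INR j))) n)%C)
      by (intros r _; rewrite Csum_scal; ring).
    rewrite Csum_minus, Csum_scal, sum_pow_eps, sum_n_switch by lia.
    set (c := (- RtoC (INR (2 * k)) * (- (1)) ^ (2 * k - 1 - l))%C).
    rewrite (Csum_ext _ (fun j => c * RtoC (g j))%C)
      by (intros j _; now apply sum_eps_partial_fraction).
    rewrite Csum_scal, Csum_RtoC, RtoC_mult. unfold c.
    assert (Es : ((- (1)) ^ (l + 1) * (- (1)) ^ (2 * k - 1 - l) = 1)%C).
    { rewrite <- Cpow_add_r. replace (l + 1 + (2 * k - 1 - l))%nat with (2 * k)%nat by lia.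
      apply Cpow_opp_1_even. }
    set (s1 := ((- (1)) ^ (l + 1))%C) in *.
    set (s2 := ((- (1)) ^ (2 * k - 1 - l))%C) in *.
    assert (Hk0 : RtoC (INR k) <> 0%C) by (apply RtoC_neq_0, not_0_INR; lia).
    rewrite mult_INR, RtoC_mult; change (INR 2) with 2.
    replace (s1 / RtoC (INR k) * (RtoC (ln (INR n)) * 0
        - - (RtoC 2 * RtoC (INR k)) * s2 * RtoC (Rsum g n)))%C
      with ((s1 * s2) * (RtoC 2 * RtoC (Rsum g n)))%C by (field; exact Hk0).
    rewrite Es; ring.
  - apply converges_scal, converges_Csum with
      (u := fun n r => (eps k r ^ (l + 1) * (RtoC (ln (INR n)) -
            Csum (fun j => / (eps k r * RtoC w + RtoC (INR j))) n))%C).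
    intros r _. apply converges_scal, digamma_converges, off_poles_Im.
    rewrite im_scal_r. apply Rmult_integral_contrapositive_currified;
      [now apply Im_eps_neq_0|lra].
Qed.

(** * Symmetric summation of a double series *)

Lemma converges_RtoC (u : nat -> R) (c : C) :
  converges (fun n => RtoC (u n)) c -> c = RtoC (Re c) /\ is_lim_seq u (Re c).
Proof.
  intros H; split.
  - assert (HI : Im c = 0).
    { assert (L : is_lim_seq (fun _ => Rabs (Im c)) 0).
      { apply (is_lim_seq_le_le (fun _ => 0) _ (fun n => Cmod (RtoC (u n) - c)));
          [|apply is_lim_seq_const|exact H].
        intros n; split; [apply Rabs_pos|].
        rewrite <- Rabs_Ropp.
        replace (- Im c) with (snd (RtoC (u n) - c)%C) by (simpl; unfold Im; ring).
        exact (Rle_trans _ _ _ (Rmax_r _ _) (Rmax_Cmod _)). }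
      apply is_lim_seq_unique in L. rewrite Lim_seq_const in L.
      injection L as L. destruct (Req_dec (Im c) 0) as [E|E]; [exact E|].
      now apply Rabs_no_R0 in E. }
    destruct c as [x y]; unfold Im, Re in *; simpl in *; now subst y.
  - apply is_lim_seq_ext with (fun n => Re c + (u n - Re c)); [intros n; ring|].
    replace (Finite (Re c)) with (Finite (Re c + 0)) by (f_equal; ring).
    apply is_lim_seq_plus'; [apply is_lim_seq_const|].
    apply is_lim_seq_abs_0.
    apply (is_lim_seq_le_le (fun _ => 0) _ (fun n => Cmod (RtoC (u n) - c)));
      [|apply is_lim_seq_const|exact H].
    intros n; split; [apply Rabs_pos|].
    replace (u n - Re c) with (Re (RtoC (u n) - c)%C) by (simpl; unfold Re; simpl; ring).
    apply re_le_Cmod.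
Qed.

Lemma converges_of_is_lim_seq (u : nat -> R) (a : R) :
  is_lim_seq u a -> converges (fun n => RtoC (u n)) (RtoC a).
Proof.
  intros H; apply is_lim_seq_ext with (fun n => Rabs (u n - a)).
  - intros n; now rewrite <- RtoC_minus, Cmod_R.
  - apply -> is_lim_seq_abs_0.
    replace (Finite 0) with (Finite (a - a)) by (f_equal; ring).
    apply is_lim_seq_minus'; [exact H|apply is_lim_seq_const].
Qed.

Lemma is_lim_seq_Rsum (t : nat -> nat -> R) (r : nat -> R) N :
  (forall i, is_lim_seq (Rsum (t i)) (r i)) ->
  is_lim_seq (fun M => Rsum (fun i => Rsum (t i) M) N) (Rsum r N).
Proof.
  intros H; induction N as [|N IH].
  - rewrite sum_O; apply is_lim_seq_ext with (2 := H O); intros n; now rewrite sum_O.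
  - rewrite Rsum_S.
    apply is_lim_seq_ext with
      (fun M => Rsum (fun i => Rsum (t i) M) N + Rsum (t (S N)) M);
      [intros n; now rewrite Rsum_S|].
    now apply is_lim_seq_plus'.
Qed.

Lemma Rsum_mono_index (u : nat -> R) n m :
  (forall j, 0 <= u j) -> (n <= m)%nat -> Rsum u n <= Rsum u m.
Proof.
  intros H Hnm; induction Hnm as [|m Hnm IH]; [apply Rle_refl|].
  rewrite Rsum_S; specialize (H (S m)); lra.
Qed.

(** On the square i, j <= N, pairing (i, j) with (j, i) makes twice the sum of t
    equal to (a_0 + ... + a_N)^2.  The iterated partial sum over i <= N and all j
    contains that square and is, for each N, a limit of rectangles contained in
    larger squares, so it lies between (a_0 + ... + a_N)^2 and A^2. *)
Lemma symmetric_double_series (t : nat -> nat -> R) (r a : nat -> R) (A : R) :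
  (forall i j, 0 <= t i j) -> (forall i, 0 <= a i) ->
  (forall i j, t i j + t j i = a i * a j) ->
  (forall i, is_lim_seq (Rsum (t i)) (r i)) ->
  is_lim_seq (Rsum a) A ->
  is_lim_seq (Rsum (fun i => 2 * r i)) (A ^ 2).
Proof.
  intros Ht Ha Hsym Hr HA.
  assert (Hsq : forall N,
    2 * Rsum (fun i => Rsum (t i) N) N = Rsum a N ^ 2).
  { intros N.
    transitivity (Rsum (fun i => Rsum (t i) N) N
                  + Rsum (fun i => Rsum (fun j => t j i) N) N).
    - rewrite <- (sum_n_switch (G := R_AbelianMonoid) t N N); ring.
    - rewrite <- (sum_n_plus (G := R_AbelianMonoid)).
      rewrite (Rsum_ext _ (fun i => Rsum a N * a i)).
      + rewrite Rsum_scal; ring.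
      + intros i. rewrite <- (sum_n_plus (G := R_AbelianMonoid)).
        rewrite (Rsum_ext _ (fun j => a i * a j))
          by (intros j; apply Hsym).
        rewrite Rsum_scal; apply Rmult_comm. }
  assert (HaA : forall N, Rsum a N <= A).
  { apply is_lim_seq_incr_compare; [exact HA|].
    intros n; rewrite Rsum_S; specialize (Ha (S n)); lra. }
  apply (is_lim_seq_le_le (fun N => Rsum a N ^ 2) _ (fun _ => A ^ 2)).
  - intros N; rewrite Rsum_scal; split.
    + rewrite <- Hsq. apply Rmult_le_compat_l; [lra|].
      apply Rsum_le; intros i.
      apply (is_lim_seq_incr_compare (Rsum (t i))); [apply Hr|].
      intros n; rewrite Rsum_S; specialize (Ht i (S n)); lra.
    + enough (H : Rbar_le (Rsum r N) (A ^ 2 / 2)) by (simpl in H; lra).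
      apply is_lim_seq_le_loc with (fun M => Rsum (fun i => Rsum (t i) M) N)
                                   (fun _ => A ^ 2 / 2).
      * exists N; intros M HM.
        apply Rle_trans with (Rsum (fun i => Rsum (t i) M) M).
        { apply Rsum_mono_index; [|exact HM].
          intros i; now apply Rsum_ge_0. }
        specialize (Hsq M).
        assert (Rsum a M ^ 2 <= A ^ 2)
          by (apply pow_incr; split; [now apply Rsum_ge_0|apply HaA]).
        lra.
      * now apply is_lim_seq_Rsum.
      * apply is_lim_seq_const.
  - simpl. apply is_lim_seq_mult'; [exact HA|].
    apply is_lim_seq_mult'; [exact HA|apply is_lim_seq_const].
  - apply is_lim_seq_const.
Qed.

Lemma zeta_nat s :
  (2 <= s)%nat ->
  exists A, zeta (RtoC (INR s)) = RtoC A /\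
    is_lim_seq (Rsum (fun i => / INR (S i) ^ s)) A.
Proof.
  intros Hs.
  destruct (ex_series_le (V := R_CompleteNormedModule)
    (fun i => / INR (S i) ^ s) (fun i => / INR (S i) ^ 2)) as [A HA].
  - intros i. assert (H1 : 1 <= INR (S i)) by (apply (le_INR 1); lia).
    change (Rabs (/ INR (S i) ^ s) <= / INR (S i) ^ 2).
    rewrite Rabs_pos_eq by (left; apply Rinv_0_lt_compat, pow_lt; lra).
    apply Rinv_le_contravar; [apply pow_lt; lra|now apply Rle_pow].
  - exact ex_series_inv_sq.
  - exists A; split; [|exact HA].
    assert (HZ : converges (Csum (fun n => Rcpow (INR (S n)) (- RtoC (INR s)))) (RtoC A)).
    { apply converges_ext with (fun n => RtoC (Rsum (fun i => / INR (S i) ^ s) n)).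
      - intros n; rewrite <- Csum_RtoC; apply Csum_ext; intros i _.
        assert (H0 : 0 < INR (S i)) by (apply lt_0_INR; lia).
        unfold Rcpow. rewrite <- RtoC_opp, <- RtoC_mult, Cexp_RtoC.
        rewrite <- Rpower_pow, <- Rpower_Ropp by exact H0; reflexivity.
      - now apply converges_of_is_lim_seq. }
    apply (iota_unique (V := C_CompleteNormedModule)).
    + intros y Hy. apply is_series_converges in Hy.
      exact (converges_unique _ _ _ Hy HZ).
    + now apply is_series_converges.
Qed.

Theorem theorem2 :
  forall k l : nat,
    (1 <= k)%nat -> (1 <= l)%nat -> (l <= 2 * k - 2)%nat ->
    is_series (K := C_AbsRing) (V := C_NormedModule)
      (fun n : nat =>
         (b k l (INR (S n))
          / Cpow (RtoC (INR (S n))) (4 * k - 2 * l - 1))%C)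
      (Cpow (zeta (RtoC (INR (2 * k - l)))) 2).
Proof.
  intros k l _ Hl1 Hl2.
  destruct (zeta_nat (2 * k - l)) as (A & -> & HA); [lia|].
  assert (Hpos : forall i, 0 < INR (S i)) by (intros i; apply lt_0_INR; lia).
  set (q := (2 * k - 1 - l)%nat).
  set (t := fun i j => INR (S j) ^ l
    / (INR (S i) ^ (2 * k - l) * (INR (S j) ^ (2 * k) + INR (S i) ^ (2 * k)))).
  assert (Hden : forall i j, 0 < INR (S j) ^ (2 * k) + INR (S i) ^ (2 * k))
    by (intros i j; apply Rplus_lt_0_compat; apply pow_lt, Hpos).
  set (r := fun i => Re (b k l (INR (S i))) / (2 * INR (S i) ^ (4 * k - 2 * l - 1))).
  assert (Hb : forall i, b k l (INR (S i)) = RtoC (Re (b k l (INR (S i)))) /\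
                         is_lim_seq (Rsum (t i)) (r i)).
  { intros i. destruct (converges_RtoC _ _ (b_converges k l _ Hl1 Hl2 (Hpos i)))
      as [E L].
    split; [exact E|].
    set (x := INR (S i)) in *. assert (Hx : 0 < x) by apply Hpos.
    assert (Hxn : forall n, x ^ n <> 0) by (intros n; apply pow_nonzero; lra).
    apply is_lim_seq_incr_1 in L.
    apply is_lim_seq_ext with (fun n => / (2 * x ^ (4 * k - 2 * l - 1)) *
      (2 * Rsum (fun m => INR m ^ l * x ^ q / (INR m ^ (2 * k) + x ^ (2 * k))) (S n))).
    - intros n.
      (* The term m = 0 vanishes because l >= 1. *)
      rewrite <- !Rsum_scal, sum_n_Reals, decomp_sum by lia; simpl pred.
      rewrite <- sum_n_Reals, pow_i by lia.
      unfold Rdiv at 1; rewrite !Rmult_0_l, !Rmult_0_r, Rplus_0_l.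
      apply Rsum_ext; intros j. unfold t; fold x.
      replace (4 * k - 2 * l - 1)%nat with (q + (2 * k - l))%nat by (unfold q; lia).
      rewrite pow_add. assert (Hd := Hden i j). fold x in Hd.
      field. repeat split; auto; lra.
    - unfold r, Rdiv; rewrite (Rmult_comm (Re _)).
      apply is_lim_seq_mult'; [apply is_lim_seq_const|exact L]. }
  apply is_series_converges.
  apply converges_ext with (fun n => RtoC (Rsum (fun i => 2 * r i) n)).
  - intros n; rewrite <- Csum_RtoC; apply Csum_ext; intros i _.
    destruct (Hb i) as [-> _].
    assert (Hp : INR (S i) ^ (4 * k - 2 * l - 1) <> 0)
      by (apply pow_nonzero; specialize (Hpos i); lra).
    rewrite <- RtoC_pow, <- RtoC_div by exact Hp. f_equal.
    unfold r; field; exact Hp.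
  - rewrite <- RtoC_pow. apply converges_of_is_lim_seq.
    apply symmetric_double_series with (t := t)
      (a := fun i => / INR (S i) ^ (2 * k - l)).
    + intros i j; left; apply Rdiv_lt_0_compat; [apply pow_lt, Hpos|].
      apply Rmult_lt_0_compat; [apply pow_lt, Hpos|apply Hden].
    + intros i; left; apply Rinv_0_lt_compat, pow_lt, Hpos.
    + intros i j. unfold t. assert (H1 := Hden i j). assert (H2 := Hden j i).
      assert (Hi := Hpos i); assert (Hj := Hpos j).
      set (x := INR (S i)) in *; set (y := INR (S j)) in *.
      assert (Hxn : forall n, x ^ n <> 0) by (intros n; apply pow_nonzero; lra).
      assert (Hyn : forall n, y ^ n <> 0) by (intros n; apply pow_nonzero; lra).
      assert (Es : (2 * k = l + (2 * k - l))%nat) by lia.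
      assert (Ex : x ^ (2 * k) = x ^ l * x ^ (2 * k - l))
        by (rewrite Es at 1; apply pow_add).
      assert (Ey : y ^ (2 * k) = y ^ l * y ^ (2 * k - l))
        by (rewrite Es at 1; apply pow_add).
      rewrite Ex, Ey in *. field. repeat split; auto; lra.
    + intros i; apply Hb.
    + exact HA.
Qed.
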